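(* Let $\beta\in(0,1)$, let $B=(B(x,z))_{x,z\ge0}$ be a standard Brownian sheet, and set $$V^\ast_\beta(u):=\sqrt{1-\beta}\int_{[0,u]}\int_{[0,\infty)}\mathbf{1}_{\{x+z^{-1/\beta}>u\}}\,dB(x,z),\quad u\ge0.$$ Then $V^\ast_\beta=(V^\ast_\beta(u))_{u\ge0}$ is a centered Gaussian process with $$\mathbb{E}\,V^\ast_\beta(u)V^\ast_\beta(s)=u^{1-\beta}-(u-s)^{1-\beta},\quad 0\le s\le u.$$ Consequently, $V^\ast_\beta$ is a version of (has the same finite-dimensional distributions as) the centered Gaussian process $V_\beta=(V_\beta(u))_{u\ge0}$ with covariance $\mathbb{E}\,V_\beta(u)V_\beta(s)=u^{1-\beta}-(u-s)^{1-\beta}$ for $0\le s\le u$.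
   Context: A standard Brownian sheet is a two-parameter continuous centered Gaussian field $B=(B(u,v))_{u,v\ge0}$ with $\mathbb{E}B(u_1,v_1)B(u_2,v_2)=(u_1\wedge u_2)(v_1\wedge v_2)$. The integral of a deterministic square-integrable function on $[0,\infty)^2$ with respect to $B$ is the Wiener (Itô) integral, i.e. the linear isometry from $L^2([0,\infty)^2,dx\,dz)$ into a space of centered jointly Gaussian random variables which sends $\mathbf{1}_{[0,u]\times[0,v]}$ to $B(u,v)$. The convention $0^{-1/\beta}=+\infty$ is used (it concerns only a null set). *)

(* Defs.v *)
From HB Require Import structures.
From mathcomp Require Import all_boot all_order all_algebra.
From mathcomp Require Import all_classical all_reals all_analysis.
Set Implicit Arguments.
Unset Strict Implicit.
Unset Printing Implicit Defensive.
Import Order.TTheory GRing.Theory Num.Theory.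
Import numFieldNormedType.Exports.
Local Open Scope classical_set_scope.
Local Open Scope ring_scope.

(* The normal law N(m, s^2), degenerate case s = 0 included: for s = 0 the
   library's normal_prob m s is the uniform law on [0, 1]. *)
Definition normal_law (R : realType) (m s : R) : set R -> \bar R :=
  if s == 0 then (fun A => \d_m A) else (fun A => normal_prob m s A).

Definition gaussian_rv (R : realType) (d : measure_display)
    (T : measurableType d) (P : probability T R) (Y : {RV P >-> R}) : Prop :=
  exists m s : R,
    forall A : set R, measurable A -> distribution P Y A = normal_law m s A.
Arguments gaussian_rv {R d T} P Y.

(* A family indexed by the subset D of J; the values of X outside D are
   irrelevant. *)
Definition centered_gaussian (R : realType) (d : measure_display)
    (T : measurableType d) (P : probability T R) (J : Type) (D : set J)
    (X : J -> {RV P >-> R}) : Prop :=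
  (forall j, D j -> ('E_P[X j] = 0)%E) /\
  (forall (n : nat) (t : 'I_n -> J) (c : 'I_n -> R),
     (forall i, D (t i)) ->
     gaussian_rv P (\sum_(i < n) c i *: (X (t i) : {mfun T >-> R}))).
Arguments centered_gaussian {R d T} P {J} D X.

Definition quadrant (R : realType) : set (R * R) := `[0, +oo[ `*` `[0, +oo[.
Arguments quadrant R : clear implicits.

Definition brownian_sheet (R : realType) (d : measure_display)
    (T : measurableType d) (P : probability T R)
    (B : R -> R -> {RV P >-> R}) : Prop :=
  [/\ {ae P, forall w,
         {within quadrant R, continuous (fun p : R * R => B p.1 p.2 w)}},
      centered_gaussian P (quadrant R) (fun p : R * R => B p.1 p.2) &
      forall u1 v1 u2 v2 : R, 0 <= u1 -> 0 <= v1 -> 0 <= u2 -> 0 <= v2 ->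
        ('E_P[B u1 v1 \* B u2 v2] =
          (Num.min u1 u2 * Num.min v1 v2)%:E)%E].
Arguments brownian_sheet {R d T} P B.

Lemma measurable_quadrant (R : realType) :
  measurable (quadrant R : set (measurableTypeR R * measurableTypeR R)).
Proof. by apply: measurableX; exact: measurable_itv. Qed.

(* dx dz on [0, oo)^2, as a measure on the plane. *)
Definition quadrant_measure (R : realType) :
    {measure set (measurableTypeR R * measurableTypeR R) -> \bar R} :=
  mrestr (lebesgue_measure \x lebesgue_measure)%E (@measurable_quadrant R).

(* W is the Wiener integral with respect to B. Elements of L^2([0, oo)^2) are
   represented by square-integrable functions f, and equalities in L^2(P) are
   almost sure equalities; W f is unconstrained when f is not in L^2. *)
Definition wiener_integral (R : realType) (d : measure_display)
    (T : measurableType d) (P : probability T R)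
    (B : R -> R -> {RV P >-> R}) (W : (R * R -> R) -> {RV P >-> R}) : Prop :=
  let L2 := [set f : R * R -> R | f \in Lfun (quadrant_measure R) 2%:E] in
  [/\ forall (a : R) (f g : R * R -> R), L2 f -> L2 g ->
        {ae P, forall w, W (fun p => a * f p + g p) w = a * W f w + W g w},
      forall f : R * R -> R, L2 f ->
        ('N[P]_2%:E [EFin \o W f] =
          'N[quadrant_measure R]_2%:E [EFin \o f])%E,
      centered_gaussian P L2 W &
      forall u v : R, 0 <= u -> 0 <= v ->
        {ae P, forall w, W \1_(`[0, u] `*` `[0, v]) w = B u v w}].
Arguments wiener_integral {R d T} P B W.

(* z^(-1/beta) for z >= 0, with 0^(-1/beta) = +oo (the library has
   0 `^ r = 0 for r != 0). *)
Definition inv_pow (R : realType) (beta z : R) : \bar R :=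
  if z == 0 then +oo%E else (z `^ (- beta^-1))%:E.

Definition Vstar_integrand (R : realType) (beta u : R) : R * R -> R :=
  \1_((`[0, u] `*` `[0, +oo[) `&`
      [set p : R * R | (u%:E < p.1%:E + inv_pow beta p.2)%E]).

Definition Vstar (R : realType) (d : measure_display) (T : measurableType d)
    (P : probability T R) (W : (R * R -> R) -> {RV P >-> R}) (beta u : R)
    : {RV P >-> R} :=
  Num.sqrt (1 - beta) *: (W (Vstar_integrand beta u) : {mfun T >-> R}).
Arguments Vstar {R d T} P W beta u.

(* X and Y may live on different probability spaces. *)
Definition same_fdd (R : realType) (d d' : measure_display)
    (T : measurableType d) (T' : measurableType d')
    (P : probability T R) (Q : probability T' R) (J : Type) (D : set J)
    (X : J -> {RV P >-> R}) (Y : J -> {RV Q >-> R}) : Prop :=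
  forall (n : nat) (t : 'I_n -> J), (forall i, D (t i)) ->
  forall A : set (n.-tuple (measurableTypeR R)), measurable A ->
    P [set w | A [tuple X (t i) w | i < n]] =
    Q [set w | A [tuple Y (t i) w | i < n]].
Arguments same_fdd {R d d' T T'} P Q {J} D X Y.

(* Main.v *)
Require Import Defs.
From HB Require Import structures.
From mathcomp Require Import all_boot all_order all_algebra.
From mathcomp Require Import all_classical all_reals all_analysis.
From mathcomp Require Import measurable_realfun.
From mathcomp Require Import ring lra.
Set Implicit Arguments.
Unset Strict Implicit.
Unset Printing Implicit Defensive.
Import Order.TTheory GRing.Theory Num.Theory.
Import numFieldNormedType.Exports.
Local Open Scope classical_set_scope.
Local Open Scope ring_scope.

(** The covariance is an area. Write D_u for the set of points (x, z) with
    0 <= x <= u, 0 <= z and x + z^(-1/beta) > u, so that the process at time u is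
    sqrt (1 - beta) times the Wiener integral of the indicator of D_u. Polarizing
    the isometry of the Wiener integral (wiener_covariance), the covariance at
    times s <= u is (1 - beta) times the area of the intersection of D_u and D_s.
    For 0 <= x < s the vertical section of D_u at x is [0, (u - x)^(-beta)[; it is
    contained in the section of D_s, so the area is the integral over [0, s[ of
    (u - x)^(-beta), namely (u^(1-beta) - (u-s)^(1-beta)) / (1 - beta)
    (Vstar_region_measure). Gaussianity and centering are inherited from the
    Wiener integral, a linear combination of values of the process being one of
    Wiener integrals.

    Equality of finite-dimensional distributions rests on two facts. A Gaussian
    law is determined by its first two moments (gaussian_law_unique): normal laws
    form a single location-scale family, whose members are the images of the
    standard one under y |-> m + s y, and any such family with a nondegenerate
    generator is parametrized by mean and variance. A law on R^n is determined by
    the laws of all linear forms (cramer_wold): those give the integrals of all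
    the functions x |-> cos (<c, x> + b), and since products of such cosines are
    averages of two of them, a multiplicative-class argument recovers every
    measurable set. Two centered Gaussian families with the same covariance
    therefore give every linear combination the same law
    (centered_gaussian_same_fdd). *)

Section bounded_measurable.
Context {R : realType} {d : measure_display} {T : measurableType d}.
Implicit Types f g : T -> R.

Definition bounded_measurable f : Prop :=
  measurable_fun setT f /\ exists M : R, forall x, `|f x| <= M.

Lemma bounded_measurable_cst (a : R) : bounded_measurable (cst a).
Proof. by split => //; exists `|a|. Qed.

Lemma bounded_measurableD f g : bounded_measurable f -> bounded_measurable g ->
  bounded_measurable (f \+ g).
Proof.
move=> [mf [M fM]] [mg [N gN]]; split; first exact: measurable_funD.
by exists (M + N) => x; rewrite (le_trans (ler_normD _ _))// lerD.
Qed.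

Lemma bounded_measurableM f g : bounded_measurable f -> bounded_measurable g ->
  bounded_measurable (f \* g).
Proof.
move=> [mf [M fM]] [mg [N gN]]; split; first exact: measurable_funM.
by exists (M * N) => x; rewrite normrM ler_pM.
Qed.

Lemma bounded_measurable_integrable (mu : {finite_measure set T -> \bar R}) f :
  bounded_measurable f -> mu.-integrable setT (EFin \o f).
Proof.
move=> [mf [M fM]]; apply: measurable_bounded_integrable => //.
  by rewrite ltey_eq fin_num_measure.
by exists M; split; [exact: num_real|move=> y My x _; exact: le_trans (fM x) (ltW My)].
Qed.

End bounded_measurable.

(** * A multiplicative-class argument *)

Section multipliers.
Context {R : realType} {d : measure_display} {T : measurableType d}.
Variables (mu nu : {finite_measure set T -> \bar R}) (E : set (T -> R)).

(** The test functions that mu and nu cannot distinguish, even after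
    multiplication by an element of E. *)
Definition agreeing (h : T -> R) : Prop :=
  bounded_measurable h /\ forall e, E e ->
    (\int[mu]_x (h x * e x)%:E = \int[nu]_x (h x * e x)%:E)%E.

(** Unlike the agreeing functions, the multipliers of that class form an algebra;
    they are closed under bounded pointwise limits as well. *)
Definition multiplier (q : T -> R) : Prop :=
  bounded_measurable q /\ forall h, agreeing h -> agreeing (h \* q).

Hypothesis E_bounded : forall e, E e -> bounded_measurable e.

Lemma agreeingD g h : agreeing g -> agreeing h -> agreeing (g \+ h).
Proof.
move=> [bg Eg] [bh Eh]; split; first exact: bounded_measurableD.
move=> e Ee; have be := E_bounded Ee.
have split_int (m : {finite_measure set T -> \bar R}) :
    (\int[m]_x ((g \+ h) x * e x)%:E =
     \int[m]_x (g x * e x)%:E + \int[m]_x (h x * e x)%:E)%E.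
  under eq_integral do rewrite mulrDl EFinD.
  by apply: integralD => //;
    apply: bounded_measurable_integrable; exact: bounded_measurableM.
by rewrite !split_int Eg// Eh.
Qed.

Lemma agreeingZ (a : R) h : agreeing h -> agreeing (h \* cst a).
Proof.
move=> [bh Eh]; split.
  by apply: bounded_measurableM => //; exact: bounded_measurable_cst.
move=> e Ee; have be := E_bounded Ee.
have pull_int (m : {finite_measure set T -> \bar R}) :
    (\int[m]_x ((h \* cst a) x * e x)%:E =
     a%:E * \int[m]_x (h x * e x)%:E)%E.
  under eq_integral do rewrite /= [_ * a]mulrC -mulrA EFinM.
  rewrite integralZl//.
  by apply: bounded_measurable_integrable; exact: bounded_measurableM.
by rewrite !pull_int Eh.
Qed.

Lemma agreeing_lim (h_ : nat -> T -> R) (h : T -> R) (K : R) :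
  (forall n, agreeing (h_ n)) -> (forall n x, `|h_ n x| <= K) ->
  (forall x, h_ n x @[n --> \oo] --> h x) -> agreeing h.
Proof.
move=> Hh hK cvh.
have hle x : `|h x| <= K.
  have : `|h_ n x| @[n --> \oo] --> `|h x| by apply: cvg_norm; exact: cvh.
  by move=> /cvgr_to_le; apply; apply: nearW => n; exact: hK.
split.
  split; last by exists K.
  by apply: (measurable_fun_cvg (fun n => (Hh n).1.1)) => x _; exact: cvh.
move=> e Ee; have [me [M eM]] := E_bounded Ee.
have cv (m : {finite_measure set T -> \bar R}) :
    (\int[m]_x (h_ n x * e x)%:E @[n --> \oo] --> \int[m]_x (h x * e x)%:E)%E.
  apply: (@dominated_cvg _ _ _ m setT _ (fun n x => (h_ n x * e x)%:E)
            (fun x => (h x * e x)%:E) (cst (K * M)%:E)) => //.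
  - move=> n; apply/measurable_EFinP; apply: measurable_funM => //.
    exact: (Hh n).1.1.
  - move=> x _; apply: cvg_EFin; first exact: nearW.
    by apply: cvgM; [exact: cvh|exact: cvg_cst].
  - exact: (bounded_measurable_integrable _ (bounded_measurable_cst (K * M))).
  - by move=> n x _ /=; rewrite lee_fin normrM ler_pM.
apply: (cvg_unique _ (cv mu)) => //.
rewrite (_ : (fun n => _) = (fun n => (\int[nu]_x (h_ n x * e x)%:E)%E)).
  exact: cv.
by apply/funext => n; exact: (Hh n).2.
Qed.

Lemma multiplier_cst (a : R) : multiplier (cst a).
Proof. by split; [exact: bounded_measurable_cst|move=> h; exact: agreeingZ]. Qed.

Lemma multiplierM p q : multiplier p -> multiplier q -> multiplier (p \* q).
Proof.
move=> [bp Hp] [bq Hq]; split; first exact: bounded_measurableM.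
move=> h /Hp /Hq; congr agreeing.
by apply/funext => x /=; rewrite mulrA.
Qed.

Lemma multiplierD p q : multiplier p -> multiplier q -> multiplier (p \+ q).
Proof.
move=> [bp Hp] [bq Hq]; split; first exact: bounded_measurableD.
move=> h Hh; rewrite (_ : _ \* _ = (h \* p) \+ (h \* q)).
  by apply: agreeingD; [exact: Hp|exact: Hq].
by apply/funext => x /=; rewrite mulrDr.
Qed.

Lemma multiplierZ (a : R) q : multiplier q -> multiplier (fun x => a * q x).
Proof. by move=> Mq; exact: (multiplierM (multiplier_cst a) Mq). Qed.

Lemma multiplier_lim (q_ : nat -> T -> R) (q : T -> R) (K : R) :
  (forall n, multiplier (q_ n)) -> (forall n x, `|q_ n x| <= K) ->
  (forall x, q_ n x @[n --> \oo] --> q x) -> multiplier q.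
Proof.
move=> Mq qK cvq.
have qle x : `|q x| <= K.
  have : `|q_ n x| @[n --> \oo] --> `|q x| by apply: cvg_norm; exact: cvq.
  by move=> /cvgr_to_le; apply; apply: nearW => n; exact: qK.
split.
  split; last by exists K.
  by apply: (measurable_fun_cvg (fun n => (Mq n).1.1)) => x _; exact: cvq.
move=> h Hh; have [_ [M hM]] := Hh.1.
apply: (@agreeing_lim (fun n => h \* q_ n) _ (M * K)).
- by move=> n; exact: (Mq n).2.
- by move=> n x /=; rewrite normrM ler_pM.
- by move=> x; apply: cvgM; [exact: cvg_cst|exact: cvq].
Qed.

(** The hypothesis is the product-to-sum identity of trigonometry: it makes
    integrals against e * e' a combination of integrals against elements of E. *)
Lemma multiplier_gen e : E e ->
  (forall e', E e' -> exists e1 e2, [/\ E e1, E e2 &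
     forall x, e x * e' x = (e1 x + e2 x) / 2]) ->
  multiplier e.
Proof.
move=> Ee EM; split; first exact: E_bounded.
move=> h Hh; split; first exact: bounded_measurableM Hh.1 (E_bounded Ee).
move=> e' /EM[e1 [e2 [Ee1 Ee2 e12]]].
have split_int (m : {finite_measure set T -> \bar R}) :
    (\int[m]_x ((h \* e) x * e' x)%:E =
     2^-1%:E * (\int[m]_x (h x * e1 x)%:E + \int[m]_x (h x * e2 x)%:E))%E.
  under eq_integral => x _.
    rewrite /= -mulrA e12 (_ : _ * _ = 2^-1 * (h x * e1 x + h x * e2 x)); last by ring.
    rewrite EFinM EFinD; over.
  have int e0 : E e0 -> m.-integrable setT (fun x => (h x * e0 x)%:E).
    move=> Ee0; apply: bounded_measurable_integrable.
    exact: bounded_measurableM Hh.1 (E_bounded Ee0).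
  rewrite integralZl//; last by apply: integrableD => //; exact: int.
  by rewrite integralD//; exact: int.
by rewrite !split_int (Hh.2 _ Ee1) (Hh.2 _ Ee2).
Qed.

(** The cubic y |-> (3 y - y^3) / 2 maps [-1, 1] to itself and fixes -1, 0 and 1;
    0 is repelling, and from u > 0 the distance to 1 shrinks at each step by a
    factor at most 1 - u / 2. Hence the discontinuous function sgn is a bounded
    pointwise limit of polynomials on [-1, 1]. *)
Lemma sgr_iter_cvg (t : R) : `|t| <= 1 ->
  iter n (fun y => (3 * y - y ^+ 3) / 2) t @[n --> \oo] --> Num.sg t.
Proof.
set g := (fun y : R => _ : R).
have pos (u : R) : 0 < u -> u <= 1 -> iter n g u @[n --> \oo] --> (1 : R).
  move=> u0 u1; set r := 1 - u / 2.
  (* The lower bound u <= iter n g u is what keeps the contraction factor below r. *)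
  have bounds n : u <= iter n g u <= 1 /\ 1 - iter n g u <= r ^+ n.
    elim: n => [|n [/andP[IH1 IH2] IH3]] /=; first by rewrite lexx u1 expr0; split => //; lra.
    move: IH1 IH2 IH3; set y := iter n g u => uy y1 yr.
    have ge1 : 1 - g y <= (1 - y) * r.
      have -> : 1 - g y = (1 - y) * ((1 - y) * (2 + y) / 2) by rewrite /g; field.
      apply: ler_wpM2l; first lra.
      rewrite /r; nra.
    have le1 : g y <= 1.
      have : 0 <= 1 - g y; last lra.
      have -> : 1 - g y = (1 - y) * ((1 - y) * (2 + y) / 2) by rewrite /g; field.
      by rewrite !mulr_ge0//; lra.
    split.
      rewrite le1 andbT (le_trans uy)//.
      rewrite -subr_ge0 (_ : _ - _ = y * (1 - y) * (1 + y) / 2); last by rewrite /g; field.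
      by rewrite !mulr_ge0//; lra.
    by rewrite (le_trans ge1)// exprSr ler_wpM2r// /r; lra.
  apply/cvgrPdist_le => e e0.
  have r0 : r ^+ n @[n --> \oo] --> 0.
    by apply: cvg_expr; rewrite ger0_norm /r; lra.
  near=> n; have [/andP[_ b1] b2] := bounds n.
  rewrite ger0_norm ?subr_ge0// (le_trans b2)//.
  have : `|0 - r ^+ n| <= e by near: n; move/cvgrPdist_le: r0; exact.
  by rewrite sub0r normrN; exact/le_trans/ler_norm.
have gN u : g (- u) = - g u by rewrite /g; field.
have iterN n u : iter n g (- u) = - iter n g u.
  by elim: n => //= n ->; exact: gN.
have [t0|t0|->] := ltgtP t 0; rewrite ?ler_norml => /andP[t1 t2].
- rewrite ltr0_sg// -(opprK t); under eq_fun do rewrite iterN.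
  by apply: cvgN; apply: pos; lra.
- by rewrite gtr0_sg//; exact: pos.
- rewrite sgr0; under eq_fun => n.
    have -> : iter n g 0 = 0 by elim: n => //= n ->; rewrite /g; field.
    over.
  exact: cvg_cst.
Unshelve. all: by end_near. Qed.

Lemma multiplier_sgr q : multiplier q -> (forall x, `|q x| <= 1) ->
  multiplier (Num.sg \o q).
Proof.
move=> Mq q1; set g := fun y : R => (3 * y - y ^+ 3) / 2.
apply: (@multiplier_lim (fun n x => iter n g (q x)) _ 1).
- elim=> [|n IHn] //=.
  rewrite (_ : (fun x => _) = (fun x => (3 / 2) * iter n g (q x)) \+
      (fun x => (- 2^-1) * (((fun x => iter n g (q x)) \* (fun x => iter n g (q x)))
         \* (fun x => iter n g (q x))) x)); last first.
    by apply/funext => x /=; rewrite /g; field.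
  by apply: multiplierD; apply: multiplierZ => //; apply: multiplierM => //;
     apply: multiplierM.
- move=> n x; elim: n => //= n.
  move: (iter n g (q x)) => y; rewrite !ler_norml => /andP[y1 y2].
  apply/andP; split.
    rewrite -subr_ge0 (_ : _ - _ = (1 + y) ^+ 2 * (2 - y) / 2).
      by rewrite !mulr_ge0// ?sqr_ge0//; lra.
    by rewrite /g; field.
  rewrite -subr_ge0 (_ : _ - _ = (1 - y) ^+ 2 * (2 + y) / 2).
    by rewrite !mulr_ge0// ?sqr_ge0//; lra.
  by rewrite /g; field.
- by move=> x; exact: sgr_iter_cvg.
Qed.

(** Complements come from 1 - q, intersections from products, and countable
    unions from bounded limits of finite ones. *)
Lemma multiplier_sigma_algebra :
  sigma_algebra setT [set A : set T | multiplier \1_A].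
Proof.
have MC A : multiplier \1_A -> multiplier \1_(~` A).
  move=> MA; rewrite (_ : \1_(~` A) = cst 1 \+ (fun x => - 1 * \1_A x)).
    by apply: multiplierD; [exact: multiplier_cst|exact: multiplierZ].
  apply/funext => x; rewrite /= !indicE in_setC.
  by case: (x \in A); rewrite /= ?mulr1 ?mulr0 ?subrr ?addr0.
split=> /=.
- rewrite (_ : \1_set0 = cst 0); first exact: multiplier_cst.
  by apply/funext => x; rewrite indicE in_set0.
- by move=> A; rewrite setTD; exact: MC.
move=> F MF.
have MU n : multiplier \1_(\big[setU/set0]_(i < n) F i).
  elim: n => [|n IHn].
    rewrite big_ord0 (_ : \1_set0 = cst 0); first exact: multiplier_cst.
    by apply/funext => x; rewrite indicE in_set0.
  rewrite big_ord_recr/= -[X in \1_X]setCK setCU; apply: (MC).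
  by rewrite indicI; apply: multiplierM; exact: (MC).
apply: (@multiplier_lim (fun n => \1_(\big[setU/set0]_(i < n) F i)) _ 1) => //.
  by move=> n x; rewrite indicE; case: (_ \in _); rewrite ?normr1 ?normr0.
move=> x; have [Fx|nFx] := pselect ((\bigcup_n F n) x).
  have [k _ Fkx] := Fx; apply: cvg_near_cst; near=> n.
  have Fnx : (\big[setU/set0]_(i < n) F i) x.
    rewrite -bigcup_mkord; exists k => //=.
    by near: n; exact: nbhs_infty_gt.
  by rewrite !indicE (mem_set Fx) (mem_set Fnx).
apply: cvg_near_cst; near=> n.
have nFnx : ~ (\big[setU/set0]_(i < n) F i) x.
  by rewrite -bigcup_mkord => -[k _ Fkx]; apply: nFx; exists k.
by rewrite !indicE (memNset nFx) (memNset nFnx).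
Unshelve. all: by end_near. Qed.

Lemma multiplier_measure_eq A : E (cst 1) -> agreeing (cst 1) ->
  measurable A -> multiplier \1_A -> mu A = nu A.
Proof.
move=> E1 H1 mA [_ /(_ _ H1)[_ /(_ _ E1)]] /=.
under eq_integral do rewrite mul1r mulr1.
under [in RHS]eq_integral do rewrite mul1r mulr1.
by rewrite !integral_indic// !setIT.
Qed.

End multipliers.

(** * The Cramer-Wold theorem *)

Section cramer_wold.
Context {R : realType} {n : nat}.
Local Notation Tn := (n.-tuple (measurableTypeR R)).

Definition tuple_lin (c : 'I_n -> R) (x : Tn) : R := \sum_(i < n) c i * tnth x i.

Lemma measurable_tuple_lin (c : 'I_n -> R) : measurable_fun setT (tuple_lin c).
Proof.
apply: measurable_sum => i; apply: measurable_funM => //.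
exact: measurable_tnth.
Qed.

HB.instance Definition _ (c : 'I_n -> R) :=
  isMeasurableFun.Build _ _ _ _ (tuple_lin c) (measurable_tuple_lin c).

(** The phase b makes sines available as well, and lets a single family be closed
    under the product-to-sum formula. *)
Definition cosines : set (Tn -> R) :=
  [set e | exists c b, e = fun x => cos (tuple_lin c x + b)].

Lemma cosines_bounded e : cosines e -> bounded_measurable e.
Proof.
move=> [c [b ->]]; split; last by exists 1 => x; exact: cos_max.
apply: measurableT_comp.
  by apply: continuous_measurable_fun; exact: continuous_cos.
by apply: measurable_funD => //; exact: measurable_tuple_lin.
Qed.

Lemma cosines1 : cosines (cst 1).
Proof.
exists (fun=> 0), 0; apply/funext => x.
by rewrite /tuple_lin big1 ?addr0 ?cos0// => i _; rewrite mul0r.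
Qed.

Lemma cosinesM e e' : cosines e -> cosines e' -> exists e1 e2,
  [/\ cosines e1, cosines e2 & forall x, e x * e' x = (e1 x + e2 x) / 2].
Proof.
move=> [c [b ->]] [c' [b' ->]].
exists (fun x => cos (tuple_lin (fun i => c i + c' i) x + (b + b'))).
exists (fun x => cos (tuple_lin (fun i => c i - c' i) x + (b - b'))).
split; [by eexists; eexists|by eexists; eexists|move=> x].
have -> : tuple_lin (fun i => c i + c' i) x + (b + b') =
    (tuple_lin c x + b) + (tuple_lin c' x + b').
  rewrite addrACA; congr (_ + _); rewrite /tuple_lin -big_split/=.
  by apply: eq_bigr => i _; rewrite mulrDl.
have -> : tuple_lin (fun i => c i - c' i) x + (b - b') =
    (tuple_lin c x + b) - (tuple_lin c' x + b').
  rewrite opprD addrACA; congr (_ + _); rewrite /tuple_lin -sumrB.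
  by apply: eq_bigr => i _; rewrite mulrBl.
have product_to_sum (y z : R) : cos y * cos z = (cos (y + z) + cos (y - z)) / 2.
  by rewrite cosD cosB; field.
exact: product_to_sum.
Qed.

Variables mu nu : {finite_measure set Tn -> \bar R}.
Hypothesis same_lin : forall (c : 'I_n -> R) (A : set R), measurable A ->
  mu (tuple_lin c @^-1` A) = nu (tuple_lin c @^-1` A).

Lemma agreeing1 : agreeing mu nu cosines (cst 1).
Proof.
split; first exact: bounded_measurable_cst.
move=> _ [c [b ->]].
have push (m : {finite_measure set Tn -> \bar R}) :
    (\int[m]_x (cst 1 x * cos (tuple_lin c x + b))%:E =
     \int[pushforward m (tuple_lin c)]_y (cos (y + b))%:E)%E.
  rewrite integral_pushforward//.
  - by rewrite preimage_setT; apply: eq_integral => x _; rewrite mul1r.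
  - apply/measurable_EFinP; apply: measurableT_comp.
      by apply: continuous_measurable_fun; exact: continuous_cos.
    exact: measurable_funD.
  - rewrite preimage_setT; apply: bounded_measurable_integrable.
    by apply: cosines_bounded; exists c, b.
rewrite !push.
apply: (eq_measure_integral (pushforward nu (tuple_lin c))) => A mA _.
exact: same_lin.
Qed.

Lemma multiplier_cosines e : cosines e -> multiplier mu nu cosines e.
Proof.
move=> Ee; apply: multiplier_gen => //; first exact: cosines_bounded.
by move=> e' Ee'; exact: cosinesM.
Qed.

(** For |t| < N + 1 the sign of sin (t / (N + 1)) is that of t, so the signs of the
    sines of a coordinate are eventually equal to the sign of the coordinate. *)
Lemma multiplier_sgr_coord (i : 'I_n) (a : R) :
  multiplier mu nu cosines (fun x => Num.sg (tnth x i - a)).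
Proof.
pose q (N : nat) (x : Tn) := sin ((tnth x i - a) / N.+1%:R).
apply: (@multiplier_lim _ _ _ _ _ _ cosines_bounded
  (fun N => Num.sg \o q N) _ 1).
- move=> N; apply: multiplier_sgr; first exact: cosines_bounded.
    apply: multiplier_cosines.
    (* The phase - pi / 2 turns the cosine into a sine. *)
    exists (fun j => if j == i then N.+1%:R^-1 else 0), (- (a / N.+1%:R) - pi / 2).
    apply/funext => x; rewrite /q /tuple_lin (bigD1 i)//= eqxx big1 ?addr0.
      by rewrite addrA cosBpihalf; congr sin; rewrite mulrBl mulrC.
    by move=> j /negbTE ->; rewrite mul0r.
  by move=> x; exact: sin_max.
- by move=> N x /=; rewrite normr_sg; case: (_ != 0).
move=> x; apply: cvg_near_cst; near=> N; rewrite /= /q.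
set t := tnth x i - a.
have N0 : 0 < N.+1%:R :> R by [].
have tN : `|t| < N.+1%:R.
  by rewrite -nat1r -ltrBlDl; near: N; exact: nbhs_infty_gtr.
have [t0|t0|->] := ltgtP t 0; last by rewrite mul0r sin0 sgr0.
- rewrite (ltr0_sg t0) ltr0_sg// -(opprK (t / _)) sinN oppr_lt0 -mulNr.
  apply: sin_gt0_pi; rewrite divr_gt0 ?oppr_gt0//= ltr_pdivrMr//.
  rewrite -(ltr0_norm t0) (lt_le_trans tN)// ler_peMl//.
  by rewrite (le_trans _ (pi_ge2 _))// ler1n.
- rewrite (gtr0_sg t0) gtr0_sg//.
  apply: sin_gt0_pi; rewrite divr_gt0//= ltr_pdivrMr//.
  rewrite -(gtr0_norm t0) (lt_le_trans tN)// ler_peMl//.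
  by rewrite (le_trans _ (pi_ge2 _))// ler1n.
Unshelve. all: by end_near. Qed.

Lemma multiplier_halfspace (i : 'I_n) (a : R) :
  multiplier mu nu cosines \1_((fun x : Tn => tnth x i) @^-1` `]a, +oo[).
Proof.
have Ms := multiplier_sgr_coord i a.
rewrite (_ : \1_ _ = (fun x => 2^-1 * (((fun x => Num.sg (tnth x i - a)) \*
   (fun x => Num.sg (tnth x i - a))) \+ (fun x => Num.sg (tnth x i - a))) x)).
  apply: multiplierZ; first exact: cosines_bounded.
  by apply: multiplierD => //; [exact: cosines_bounded|exact: multiplierM].
(* The indicator of t > 0 is (sgn t ^+ 2 + sgn t) / 2. *)
apply/funext => x; rewrite indicE/=.
have [t0|t0|t0] := ltgtP (tnth x i - a) 0.
- rewrite ltr0_sg// memNset; first by rewrite mulN1r opprK subrr mulr0.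
  by rewrite /= in_itv/= andbT -subr_gt0 => /ltW; rewrite leNgt t0.
- rewrite gtr0_sg// mem_set; first by rewrite mulr1 mulVf.
  by rewrite /= in_itv/= andbT -subr_gt0.
- rewrite t0 sgr0 memNset; first by rewrite mulr0 addr0 mulr0.
  by rewrite /= in_itv/= andbT -subr_gt0 t0 ltxx.
Qed.

Lemma multiplier_measurable :
  measurable `<=` [set A : set Tn | multiplier mu nu cosines \1_A].
Proof.
have [S0 SC SU] := multiplier_sigma_algebra mu nu cosines_bounded.
apply: smallest_sub; first by split.
move=> B; rewrite -bigcup_seq => -[i _ [C + <-]].
rewrite setTI.
have -> : measurable = <<s @RGenOInfty.G R >> :> set (set (measurableTypeR R)).
  exact: RGenOInfty.measurableE.
move: C; apply: smallest_sub.
  split => /=.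
  - by rewrite preimage_set0.
  - by move=> C MC; rewrite setTD -preimage_setC -setTD; exact: SC.
  - by move=> F MF; rewrite preimage_bigcup; exact: SU.
by move=> _ [a ->]; exact: multiplier_halfspace.
Qed.

(** Open half-spaces along the coordinates generate the Borel sets, and their
    indicators are multipliers; as the constant 1 is agreeing, the indicator
    of a Borel set has the same integral under both measures. *)
Theorem cramer_wold (A : set Tn) : measurable A -> mu A = nu A.
Proof.
move=> mA; apply: (multiplier_measure_eq (E := cosines)) => //.
- exact: cosines1.
- exact: agreeing1.
- exact: multiplier_measurable.
Qed.

End cramer_wold.

(** * Normal laws as a location-scale family *)

Section location_scale.
Context {R : realType}.

(** The source is the Borel line underlying normal_prob, the target the one in
    which random variables take their values. *)
Definition affine (m s : R) : measurableTypeR R -> R := fun y : R => m + s * y.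

Lemma measurable_affine (m s : R) : measurable_fun setT (affine m s).
Proof. by apply: measurable_funD => //; exact: measurable_funM. Qed.

HB.instance Definition _ (m s : R) :=
  isMeasurableFun.Build _ _ _ _ (affine m s) (measurable_affine m s).

(** By uniqueness of Lebesgue measure, it suffices to compare lengths of
    intervals. *)
Lemma lebesgue_measure_affine (m s : R) (A : set (measurableTypeR R)) :
  0 < s -> measurable A ->
  (lebesgue_measure A = s%:E * lebesgue_measure (affine m s @^-1` A))%E.
Proof.
move=> s0 mA; pose c := NngNum (ltW s0).
pose nu : {measure set (measurableTypeR R) -> \bar R} :=
  mscale c (pushforward (@lebesgue_measure R)
      (affine m s : measurableTypeR R -> measurableTypeR R)).
apply: (@lebesgue_measure_unique _ (nu (measurable_affine m s))) => // X [[a b] _ <-].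
rewrite -[RHS]/(s%:E * lebesgue_measure (affine m s @^-1` `]a, b]))%E.
have -> : affine m s @^-1` `]a, b] = `](a - m) / s, (b - m) / s]%classic.
  apply/seteqP; split => y /=; rewrite /affine !in_itv/=;
    by rewrite ltr_pdivrMr// ler_pdivlMr// ltrBlDl lerBrDl mulrC.
rewrite !lebesgue_measure_itv/= !lte_fin ltr_pM2r ?invr_gt0// ltrD2r.
case: ifPn => _; last by rewrite mule0.
by rewrite -!EFinB -EFinM -mulrBl mulrC divfK ?gt_eqF// opprB addrA subrK.
Qed.

Lemma normal_pdf_affine (m s y : R) : s != 0 ->
  `|s| * normal_pdf m s (affine m `|s| y) = normal_pdf 0 1 y.
Proof.
move=> s0; rewrite !normal_pdfE ?oner_neq0//.
have s2 : 0 < `|s| by rewrite normr_gt0.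
rewrite /normal_peak /normal_fun /affine mulrA; congr (_ * expR _).
  rewrite expr1n mul1r -mulrnAr sqrtrM ?sqr_ge0// sqrtr_sqr invfM mulrA mulfV ?mul1r//.
  by rewrite gt_eqF.
rewrite addrAC subrr add0r subr0 exprMn real_normK ?num_real// expr1n.
by field.
Qed.

Lemma normal_prob_affine (m s : R) (A : set (measurableTypeR R)) :
  s != 0 -> measurable A ->
  normal_prob m s A = normal_prob 0 1 (affine m `|s| @^-1` A).
Proof.
move=> s0 mA; have s2 : 0 < `|s| by rewrite normr_gt0.
pose c := NngNum (ltW s2).
pose nu : {measure set (measurableTypeR R) -> \bar R} :=
  mscale c (pushforward (@lebesgue_measure R)
      (affine m `|s| : measurableTypeR R -> measurableTypeR R)).
have maff : measurable_fun setT (affine m `|s| : measurableTypeR R -> measurableTypeR R).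
  exact: measurable_affine.
have mpre : measurable (affine m `|s| @^-1` A).
  by rewrite -[X in measurable X]setTI; exact: measurable_affine.
have mpdf : measurable_fun setT (fun x => (normal_pdf m s x)%:E).
  by apply/measurable_EFinP; exact: measurable_normal_pdf.
rewrite /normal_prob (eq_measure_integral (nu (measurable_affine m `|s|))); last first.
  by move=> B mB _; exact: lebesgue_measure_affine.
rewrite ge0_integral_mscale//; last first.
- by move=> x _; rewrite lee_fin normal_pdf_ge0.
- exact: measurable_funTS.
rewrite (ge0_integral_pushforward maff)//; last first.
- by move=> x _; rewrite lee_fin normal_pdf_ge0.
- exact: measurable_funTS.
rewrite -ge0_integralZl_EFin//; last first.
- apply: measurable_funTS; apply: measurableT_comp => //.
- by move=> x _; rewrite lee_fin normal_pdf_ge0.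
by apply: eq_integral => y _; rewrite -EFinM/= normal_pdf_affine.
Qed.

(** The degenerate law is covered too: for s = 0 the affine map is constant and
    its image measure is the Dirac mass at m. *)
Lemma normal_law_affine (m s : R) (A : set R) : measurable A ->
  normal_law m s A = normal_prob 0 1 (affine m `|s| @^-1` A).
Proof.
move=> mA; rewrite /normal_law; have [->|s0] := eqVneq s 0; last first.
  exact: normal_prob_affine.
rewrite normr0 diracE; have [mA'|mA'] := boolP (m \in A).
  rewrite (_ : _ @^-1` _ = setT) ?probability_setT//.
  by apply/seteqP; split => // y _; rewrite /affine /= mul0r addr0; exact: set_mem.
rewrite (_ : _ @^-1` _ = set0) ?measure0//.
apply/seteqP; split => // y; rewrite /affine /= mul0r addr0 => mA''.
by move: mA'; rewrite mem_set.
Qed.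

(** A law of variance zero is carried by a point, which is negligible for the
    standard normal law by absolute continuity. *)
Lemma variance_normal_prob_gt0 :
  idfun \in Lfun (normal_prob 0 1 : probability (measurableTypeR R) R) 2%:E ->
  (0 < 'V_(normal_prob 0 1 : probability (measurableTypeR R) R)[idfun])%E.
Proof.
move=> L2; rewrite lt_neqAle variance_ge0 andbT eq_sym.
set g := (normal_prob 0 1 : probability _ _).
apply/eqP; rewrite /variance unlock unlock.
set e := fine _.
move=> V0.
have /ae_eq_integral_abs : (\int[g]_y `|((y - e) ^+ 2)%:E| = 0)%E.
  rewrite -[RHS]V0; apply: eq_integral => y _.
  by rewrite gee0_abs ?lee_fin ?sqr_ge0// expr2.
have mE : measurable_fun setT (fun y : measurableTypeR R => ((y - e) ^+ 2)%:E).
  by apply/measurable_EFinP; apply: measurable_funX; exact: measurable_funB.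
move=> /(_ measurableT mE) [N [mN N0 subN]].
have ge : g [set e] = 0%E.
  have := @normal_prob_dominates R 0 1.
  move=> /null_content_dominatesP; apply => //.
  exact: lebesgue_measure_set1.
have gNe : g (~` [set e]) = 0%E.
  apply: (subset_measure0 (B := N)) => //; first exact: measurableC.
  move=> y /= ye; apply: subN => /= /(_ I) /eqP.
  by rewrite eqe sqrf_eq0 subr_eq0 => /eqP.
have gT : (g [set e] + g (~` [set e]) = 1)%E.
  rewrite -(probability_setT g) -(setUv [set e]) measureU//.
  - exact: measurableC.
  - exact: setICr.
by move: gT; rewrite ge gNe adde0 => /eqP; rewrite eqe eq_sym oner_eq0.
Qed.

End location_scale.

(** * Gaussian laws are determined by two moments *)

Section square_integrable.
Context {R : realType} {d : measure_display} {T : measurableType d}.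
Variable mu : {measure set T -> \bar R}.

Lemma poweR_Lnorm2 (f : T -> R) :
  ('N[mu]_2%:E[EFin \o f] `^ 2 = \int[mu]_x (f x ^+ 2)%:E)%E.
Proof.
rewrite poweR_Lnorm//; apply: eq_integral => x _ /=.
by rewrite powR_mulrn// real_normK// num_real.
Qed.

Lemma Lfun2P (f : T -> R) : measurable_fun setT f ->
  (\int[mu]_x (f x ^+ 2)%:E < +oo)%E -> f \in Lfun mu 2%:E.
Proof.
move=> mf f2; rewrite inE; apply/andP; split; rewrite inE//=.
by rewrite /finite_norm (@lty_poweRy _ _ 2)// poweR_Lnorm2.
Qed.

End square_integrable.

Section gaussian_law.
Context {R : realType}.
Local Notation gamma := (normal_prob 0 1 : probability (measurableTypeR R) R).

(** The two moments of Z become those of an affine function of a standard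
    normal variable, and square integrability of that function follows from the
    finiteness of v. *)
Lemma gaussian_standardize d (T : measurableType d) (P : probability T R)
    (Z : {RV P >-> R}) (v : R) :
  gaussian_rv P Z -> ('E_P[Z] = 0)%E -> (\int[P]_w (Z w ^+ 2)%:E = v%:E)%E ->
  exists m s, [/\ 0 <= s,
    forall A : set R, measurable A -> distribution P Z A = gamma (affine m s @^-1` A),
    (affine m s : _ -> R) \in Lfun gamma 2%:E,
    ('E_gamma[affine m s] = 0)%E &
    ('V_gamma[affine m s] = v%:E)%E].
Proof.
move=> [m [s0 ZE0]] EZ VZ; exists m, `|s0|; set s := `|s0|.
have ZE (A : set R) : measurable A -> distribution P Z A = gamma (affine m s @^-1` A).
  by move=> mA; rewrite ZE0// normal_law_affine.
have s_ge0 : 0 <= s by exact: normr_ge0.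
have mZ : measurable_fun setT Z by exact: measurable_funPT.
have m2 : measurable_fun setT (fun x : R => (x ^+ 2)%:E).
  by apply/measurable_EFinP; exact: measurable_funX.
have transfer (f : R -> \bar R) :
    (\int[distribution P Z]_x f x = \int[distribution gamma (affine m s)]_x f x)%E.
  apply: (eq_measure_integral (distribution gamma (affine m s))) => A mA _.
  exact: ZE.
have aff2 : (\int[gamma]_y (affine m s y ^+ 2)%:E = v%:E)%E.
  rewrite -VZ.
  transitivity (\int[distribution P Z]_x (x ^+ 2)%:E)%E; last first.
    by rewrite ge0_integral_distribution// => x; rewrite lee_fin sqr_ge0.
  by rewrite transfer ge0_integral_distribution// => x; rewrite lee_fin sqr_ge0.
have L2aff : (affine m s : _ -> R) \in Lfun gamma 2%:E.
  by apply: Lfun2P; [exact: measurable_affine|rewrite aff2 ltry].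
have L2Z : (Z : _ -> R) \in Lfun P 2%:E by apply: Lfun2P => //; rewrite VZ ltry.
have Pfin (d' : measure_display) (T' : measurableType d') (Q : probability T' R) :
    Q setT \is a fin_num by rewrite fin_num_measure.
have Eaff : ('E_gamma[affine m s] = 0)%E.
  rewrite -EZ unlock.
  transitivity (\int[distribution P Z]_x x%:E)%E; last first.
    rewrite integral_distribution//; apply/Lfun1_integrable.
    exact: (Lfun_subset12 (Pfin _ _ _)).
  rewrite transfer integral_distribution//; apply/Lfun1_integrable.
  exact: (Lfun_subset12 (Pfin _ _ _)).
split => //.
rewrite varianceE// Eaff expe2 mule0 sube0 unlock -aff2.
by apply: eq_integral.
Qed.

(** If the law of Z is the image of the standard normal law under m + s y, its
    variance is s^2 times that of the standard law, which is positive: the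
    variance determines s, and the mean then determines m. *)
Lemma gaussian_law_unique d (T : measurableType d) (P : probability T R)
    d' (T' : measurableType d') (P' : probability T' R)
    (Z : {RV P >-> R}) (Z' : {RV P' >-> R}) (v : R) :
  gaussian_rv P Z -> gaussian_rv P' Z' ->
  ('E_P[Z] = 0)%E -> ('E_P'[Z'] = 0)%E ->
  (\int[P]_w (Z w ^+ 2)%:E = v%:E)%E -> (\int[P']_w (Z' w ^+ 2)%:E = v%:E)%E ->
  forall A : set R, measurable A -> distribution P Z A = distribution P' Z' A.
Proof.
move=> gZ gZ' EZ EZ' VZ VZ'.
have [m [s [s0 ZE L2 Eaff Vaff]]] := gaussian_standardize gZ EZ VZ.
have [m' [s' [s'0 ZE' L2' Eaff' Vaff']]] := gaussian_standardize gZ' EZ' VZ'.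
suff [mm ss] : m = m' /\ s = s' by move=> A mA; rewrite ZE// ZE'// mm ss.
have affE (a b : R) : affine a b = (cst a \+ (b \o* idfun))%R :> (R -> R).
  by apply/funext => y; rewrite /affine/= mulrC.
have Pfin : gamma setT \is a fin_num by rewrite fin_num_measure.
have L2id (a b : R) : 0 <= b -> b != 0 -> (affine a b : _ -> R) \in Lfun gamma 2%:E ->
    (idfun : R -> R) \in Lfun gamma 2%:E.
  move=> b0 bn0 aff2.
  have -> : (idfun : R -> R) = (b^-1 \o* (affine a b \- cst a))%R.
    by apply/funext => y; rewrite /affine/= addrAC subrr add0r mulrAC divff// mul1r.
  apply: Lfun_scale; first by rewrite ler1n.
  by apply: rpredB => //; [rewrite lee1n|move=> ?; exact: Lfun_cst].
(* Once the scales agree, both means differ from the location by the same amount. *)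
have scale_eq : s = s' -> m = m' /\ s = s'.
  move=> ss; split => //; move: Eaff Eaff'; rewrite -ss.
  have [sE|sn0] := eqVneq s 0.
    rewrite sE !affE.
    have aff0 (a : R) : (cst a \+ (0 \o* idfun))%R = cst a :> (R -> R).
      by apply/funext => y; rewrite /= mulr0 addr0.
    by rewrite !aff0 !expectation_cst => -[->] [->].
  have L1 : (s \o* (idfun : R -> R))%R \in Lfun gamma 1.
    by apply: Lfun_scale => //; apply: (Lfun_subset12 Pfin); exact: (L2id m s).
  rewrite !affE !expectationD ?Lfun_cst// !expectation_cst => E1 E2.
  have : ((m%:E - m'%:E) = 0)%E; last by rewrite -EFinB => -[] /eqP; rewrite subr_eq0 => /eqP.
  have fE := expectation_fin_num L1.
  move: E1 E2; rewrite -(fineK fE) -!EFinD => -[E1] [E2].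
  by congr EFin; lra.
have VE (a b : R) : (idfun : R -> R) \in Lfun gamma 2%:E ->
    ('V_gamma[affine a b] = (b ^+ 2)%:E * 'V_gamma[idfun])%E.
  move=> Lid; rewrite affE varianceD_cst_l ?varianceZ//.
  by apply: Lfun_scale => //; rewrite ler1n.
apply: scale_eq.
(* Without a square-integrable standard law both scales would have to vanish. *)
have [Lid|nLid] := pselect ((idfun : R -> R) \in Lfun gamma 2%:E).
  have V0 := variance_normal_prob_gt0 Lid.
  have := Vaff; rewrite -Vaff' !VE//.
  have fV := variance_fin_num Lid.
  move: V0; rewrite -(fineK fV) -!EFinM lte_fin => V0 [] /mulIf.
  rewrite gt_eqF// => /(_ isT)/eqP.
  by rewrite eqrXn2// => /eqP.
have [->|sn0] := eqVneq s 0; last by exfalso; apply: nLid; exact: (L2id m s).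
have [->//|s'n0] := eqVneq s' 0; by exfalso; apply: nLid; exact: (L2id m' s').
Qed.

End gaussian_law.

(** * The area of the intersection of two regions *)

Section power_integral.
Context {R : realType}.
Local Notation mu := (@lebesgue_measure R).
Implicit Types a u t : R.

Lemma is_derive_powR_subl a u x : x < u ->
  is_derive x 1 (fun y : R => (u - y) `^ a) (- (a * (u - x) `^ (a - 1))).
Proof.
move=> xu; have ux : 0 < u - x by rewrite subr_gt0.
have H : is_derive x (1:R) (fun y : R => u - y) (- 1).
  by rewrite -[- 1]sub0r; apply: is_deriveB.
have := @is_derive1_comp R (fun y : R => y `^ a) (fun y : R => u - y) x _ _ (is_derive1_powR a ux) H.
by rewrite mulrN1.
Qed.

Lemma continuous_powR_subl a u x : x < u ->
  {for x, continuous (fun y : R => (u - y) `^ a)}.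
Proof.
move=> xu; apply: differentiable_continuous; apply/derivable1_diffP.
exact: (@ex_derive _ _ _ _ _ _ _ (is_derive_powR_subl a xu)).
Qed.

Lemma integral_powR_subl_lt beta u t : beta < 1 -> 0 <= t -> t < u ->
  (\int[mu]_(x in `[0%R, t]) ((u - x) `^ (- beta))%:E =
   ((u `^ (1 - beta) - (u - t) `^ (1 - beta)) / (1 - beta))%:E)%E.
Proof.
move=> b1; rewrite le_eqVlt => /predU1P[<-|t0] tu.
  by rewrite set_itv1 integral_set1 subr0 subrr mul0r.
have b0 : 1 - beta != 0 by rewrite gt_eqF// subr_gt0.
pose F (x : R) := - (1 - beta)^-1 * (u - x) `^ (1 - beta).
have dF x : x < u -> is_derive x 1 F ((u - x) `^ (- beta)).
  move=> xu; have H := is_derive_powR_subl (1 - beta) xu.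
  have := @is_deriveZ _ _ _ _ (- (1 - beta)^-1) _ _ _ H.
  move=> H'; apply: is_derive_eq.
  rewrite /GRing.scale/= mulrNN mulKf//; congr (_ `^ _); ring.
have cF x : x < u -> {for x, continuous F}.
  move=> xu; apply: differentiable_continuous; apply/derivable1_diffP.
  exact: (@ex_derive _ _ _ _ _ _ _ (dF _ xu)).
rewrite (@continuous_FTC2 _ _ F)//.
- by rewrite -EFinB /F subr0; congr EFin; field.
- apply: continuous_in_subspaceT => x; rewrite inE/= in_itv/= => /andP[_ xt].
  by apply: continuous_powR_subl; exact: le_lt_trans tu.
- split.
  + move=> x; rewrite in_itv/= => /andP[_ xt].
    exact: (@ex_derive _ _ _ _ _ _ _ (dF _ (lt_trans xt tu))).
  + by apply: cvg_at_right_filter; apply: cF; exact: lt_trans tu.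
  + by apply: cvg_at_left_filter; exact: cF.
- move=> x; rewrite in_itv/= => /andP[_ xt].
  rewrite derive1E; exact: (@derive_val _ _ _ _ _ _ _ (dF _ (lt_trans xt tu))).
Qed.

(** For s = u the integrand blows up at the end point: the integral is the limit
    of those over [0, u - u / (n + 1)], and (u / (n + 1))^(1 - beta) tends to 0
    because 1 - beta > 0. *)
Lemma integral_powR_subl beta u s : 0 < beta < 1 -> 0 <= s -> s <= u ->
  (\int[mu]_(x in `[0%R, s[) ((u - x) `^ (- beta))%:E =
   ((u `^ (1 - beta) - (u - s) `^ (1 - beta)) / (1 - beta))%:E)%E.
Proof.
move=> /andP[b0 b1] s0.
have b10 : 1 - beta != 0 by rewrite gt_eqF// subr_gt0.
have mf (D : set (measurableTypeR R)) : measurable_fun D (fun x : R => ((u - x) `^ (- beta))%:E).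
  apply: measurable_funTS; apply/measurable_EFinP.
  by apply: (measurableT_comp (measurable_powR _)) => //; exact: measurable_funB.
rewrite le_eqVlt => /predU1P[su|su]; last first.
  by rewrite integral_itv_bndo_bndc; [exact: integral_powR_subl_lt|exact: mf].
move: s0; rewrite {}su le_eqVlt => /predU1P[<-|u0].
  by rewrite set_itvco0 integral_set0 subr0 subrr mul0r.
pose F (n : nat) : set (measurableTypeR R) := `[0, u - u / n.+1%:R]%classic.
have un (n : nat) : 0 <= u - u / n.+1%:R < u.
  rewrite subr_ge0 ler_pdivrMr// ler_peMr ?ler1n//=; last exact: ltW.
  by rewrite ltrBlDr ltrDl divr_gt0.
have <- : \bigcup_n F n = `[0%R, u[%classic.
  apply/seteqP; split => [x [n _]|x]; rewrite /F /= !in_itv/= => /andP[x0 xu].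
    by rewrite x0 (le_lt_trans xu)//; case/andP: (un n).
  have ux : 0 < (u - x) / u by rewrite divr_gt0// subr_gt0.
  have [n nux] := ltr_add_invr ux.
  exists n => //=; rewrite in_itv/= x0 lerBrDl -lerBrDr.
  by move: nux; rewrite add0r ltr_pdivlMr// mulrC => /ltW.
have cv := @ge0_nondecreasing_set_cvg_integral _ (measurableTypeR R) R F
  (fun x : R => ((u - x) `^ (- beta))%:E) mu.
apply: (cvg_unique _ (cv _ _ _ _)) => //.
- move=> n m nm; apply/subsetPset => x; rewrite /F /= !in_itv/= => /andP[-> /=].
  move=> /le_trans; apply; rewrite lerB// ler_pM2l// lef_pV2 ?posrE// ler_nat//.
- by move=> n; exact: measurable_itv.
- by move=> n x _; rewrite lee_fin powR_ge0.
rewrite (_ : (fun n => _) = (fun n => ((u `^ (1 - beta) - (u / n.+1%:R) `^ (1 - beta)) / (1 - beta))%:E)); last first.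
  apply/funext => n; have /andP[un0 un1] := un n.
  by rewrite integral_powR_subl_lt// subKr.
apply: cvg_EFin; first exact: nearW.
rewrite subrr powR0//; apply: cvgMl; apply: cvgB; first exact: cvg_cst.
have harm : u / n.+1%:R @[n --> \oo] --> 0^'+.
  have cv0 : u / n.+1%:R @[n --> \oo] --> 0.
    by rewrite -[0](mulr0 u); apply: cvgMr; exact: cvg_harmonic.
  move=> Q HQ.
  have cvQ : \forall n \near \oo, 0 < u / n.+1%:R -> Q (u / n.+1%:R).
    exact: (cv0 _ HQ).
  suff : \forall n \near \oo, Q (u / n.+1%:R) by [].
  by apply: filterS cvQ => n; apply; rewrite divr_gt0.
have b2 : 0 < 1 - beta by rewrite subr_gt0.
exact: cvg_comp harm (powR_cvg0 b2).
Qed.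

End power_integral.

Section region.
Context {R : realType}.
Implicit Types beta u s w z : R.
Local Notation Plane := (measurableTypeR R * measurableTypeR R)%type.

Definition Vstar_region beta u : set Plane :=
  (`[0, u] `*` `[0, +oo[) `&`
  [set p : R * R | (u%:E < p.1%:E + inv_pow beta p.2)%E].

Lemma measurable_inv_pow beta : measurable_fun setT (inv_pow beta).
Proof.
apply: measurable_fun_ifT => //.
- exact: measurable_fun_eqr.
- by apply/measurable_EFinP; exact: measurable_powR.
Qed.

Lemma measurable_Vstar_region beta u : measurable (Vstar_region beta u).
Proof.
apply: measurableI.
  by apply: measurableX; exact: measurable_itv.
rewrite -[X in measurable X]setTI.
apply: emeasurable_fun_o_infty => //.
apply: emeasurable_funD.
  by apply/measurable_EFinP; exact: measurable_fst.
by apply: (measurableT_comp (measurable_inv_pow beta)); exact: measurable_snd.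
Qed.

Lemma lt_inv_pow beta w z : 0 < beta -> 0 < w -> 0 <= z ->
  (w%:E < inv_pow beta z)%E = (z < w `^ (- beta)).
Proof.
move=> b0 w0 z0; rewrite /inv_pow; case: eqVneq => [->|zn0].
  by rewrite ltry powR_gt0.
have {zn0 z0}z0 : 0 < z by rewrite lt_neqAle eq_sym zn0.
rewrite lte_fin !powRN; apply/idP/idP => h.
- have : w `^ beta < z^-1.
    have -> : z^-1 = ((z `^ beta^-1)^-1) `^ beta.
      by rewrite -powRN -powRrM mulNr mulVf ?gt_eqF// powR_inv1 ?ltW.
    by apply: gt0_ltr_powR => //; rewrite nnegrE ?invr_ge0 ?powR_ge0// ltW.
  by rewrite -ltf_pV2 ?posrE ?invr_gt0 ?powR_gt0// invrK.
- have : (w `^ beta) `^ beta^-1 < z^-1 `^ beta^-1.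
    apply: gt0_ltr_powR; rewrite ?invr_gt0 ?nnegrE ?invr_ge0 ?powR_ge0//; first exact: ltW.
    by rewrite -ltf_pV2 ?posrE ?invr_gt0 ?powR_gt0// invrK.
  rewrite -powRrM mulfV ?gt_eqF// powRr1 ?ltW// => /lt_le_trans; apply.
  by rewrite -(powR_inv1 (ltW z0)) -powRrM mulN1r powRN.
Qed.

(** The area is computed by vertical sections. The point x = s is left out: when
    s = u, the section there is the whole half-line. *)
Lemma Vstar_region_measure beta u s : 0 < beta < 1 -> 0 <= s -> s <= u ->
  (quadrant_measure R (Vstar_region beta u `&` Vstar_region beta s) =
   ((u `^ (1 - beta) - (u - s) `^ (1 - beta)) / (1 - beta))%:E)%E.
Proof.
move=> b01 s0 su; have /andP[b0 b1] := b01.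
set A := _ `&` _.
have mV : measurable A by apply: measurableI; exact: measurable_Vstar_region.
have AQ : A `<=` quadrant R.
  by move=> [x z] [[[+ +] _] _]; rewrite /quadrant/= !in_itv/= !andbT => /andP[].
transitivity ((lebesgue_measure \x lebesgue_measure)%E (A `&` quadrant R)) => //.
rewrite (setIidl AQ) /product_measure1.
have mA : measurable_fun setT (lebesgue_measure \o xsection A).
  exact: measurable_fun_xsection.
have A0 x : x \notin `[0, s] -> lebesgue_measure (xsection A x) = 0%E.
  move=> xs; rewrite (_ : xsection A x = set0) ?measure0//.
  apply/seteqP; split => // z; rewrite /xsection/= inE => -[_ [[/= + _] _]].
  by move=> xs'; move: xs; rewrite xs'.
have AE x : x \in `[0, s[ ->
    (lebesgue_measure (xsection A x) = ((u - x) `^ (- beta))%:E)%E.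
  rewrite in_itv/= => /andP[x0 xs].
  have ux : 0 < u - x by rewrite subr_gt0 (lt_le_trans xs).
  have sx : 0 < s - x by rewrite subr_gt0.
  rewrite (_ : xsection A x = `[0, (u - x) `^ (- beta)[%classic).
    rewrite lebesgue_measure_itv/= lte_fin powR_gt0//.
    by rewrite oppr0 adde0.
  have regE (v z : R) : 0 <= z -> (v%:E < x%:E + inv_pow beta z)%E = ((v - x)%:E < inv_pow beta z)%E.
    by move=> z0; rewrite EFinB lteBlDl.
  apply/seteqP; split => z; rewrite /xsection/= inE/= in_itv/=.
    move=> [[[/= _ +] +] _]; rewrite in_itv/= andbT => z0.
    by rewrite regE// lt_inv_pow// z0.
  move=> /andP[z0 zu].
  have zs : z < (s - x) `^ (- beta).
    rewrite (lt_le_trans zu)// !powRN lef_pV2 ?posrE ?powR_gt0//.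
    by apply: ge0_ler_powR; rewrite ?nnegrE ?lerB// ltW.
  by split; split; rewrite /= ?regE ?lt_inv_pow//; split; rewrite /= in_itv/= ?x0 ?z0//= ltW// (lt_le_trans xs).
transitivity (\int[lebesgue_measure]_(x in `[0%R, s])
  lebesgue_measure (xsection A x))%E.
  rewrite [RHS]integral_mkcond; apply: eq_integral => x _.
  rewrite patchE; case: ifPn => // xs; apply: A0.
  by apply: contra xs => xs; rewrite inE.
rewrite -integral_itv_bndo_bndc; last exact: measurable_funTS.
rewrite -(integral_powR_subl b01 s0 su); apply: eq_integral => x.
by rewrite inE/= => xs; exact: AE.
Qed.

End region.

(** * Covariances of Wiener integrals *)

Section square_expansion.
Context {R : realType} {d : measure_display} {T : measurableType d}.
Variable mu : {measure set T -> \bar R}.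
Implicit Types f g : T -> R.

Lemma integrable_mul2 f g : f \in Lfun mu 2%:E -> g \in Lfun mu 2%:E ->
  mu.-integrable setT (fun x => (f x * g x)%:E).
Proof. by move=> lf lg; apply/Lfun1_integrable; exact: Lfun2_mul_Lfun1. Qed.

Lemma integral_sqrD f g : f \in Lfun mu 2%:E -> g \in Lfun mu 2%:E ->
  (\int[mu]_x ((f x + g x) ^+ 2)%:E =
   \int[mu]_x (f x ^+ 2)%:E + \int[mu]_x (g x ^+ 2)%:E +
   2%:E * \int[mu]_x (f x * g x)%:E)%E.
Proof.
move=> lf lg.
have iff := Lfun2_integrable_sqr lf; have igg := Lfun2_integrable_sqr lg.
have ifg := integrable_mul2 lf lg.
transitivity (\int[mu]_x ((f x ^+ 2)%:E + (g x ^+ 2)%:E +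
    2%:E * (f x * g x)%:E))%E.
  apply: eq_integral => x _; rewrite -EFinM -!EFinD; congr EFin; ring.
rewrite integralD//; last 2 first.
- exact: integrableD.
- exact: integrableZl.
by rewrite integralD// integralZl.
Qed.

Lemma integral_sqr_sum (n : nat) (f : 'I_n -> T -> R) (c : 'I_n -> R) :
  (forall i, f i \in Lfun mu 2%:E) ->
  (\int[mu]_x ((\sum_(i < n) c i * f i x) ^+ 2)%:E =
   \sum_(i < n) \sum_(j < n) (c i * c j)%:E * \int[mu]_x (f i x * f j x)%:E)%E.
Proof.
move=> lf.
have ifg i j : mu.-integrable setT (fun x => (f i x * f j x)%:E).
  exact: integrable_mul2.
transitivity (\int[mu]_x (\sum_(i < n) \sum_(j < n)
    (c i * c j)%:E * (f i x * f j x)%:E))%E.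
  apply: eq_integral => x _; rewrite expr2 mulr_suml -sumEFin.
  apply: eq_bigr => i _; rewrite mulr_sumr -sumEFin; apply: eq_bigr => j _.
  by rewrite -EFinM mulrACA.
rewrite integral_sum//; last first.
  by move=> i; apply: integrable_sum => // j _; exact: integrableZl.
apply: eq_bigr => i _; rewrite integral_sum//; last by move=> j; exact: integrableZl.
by apply: eq_bigr => j _; rewrite integralZl.
Qed.

End square_expansion.

Section isometry.
Context {R : realType} {d : measure_display} {T : measurableType d}.
Variables (P : probability T R) (B : R -> R -> {RV P >-> R}).
Variable W : (R * R -> R) -> {RV P >-> R}.
Hypothesis hW : wiener_integral P B W.
Local Notation mu := (quadrant_measure R).

Lemma wiener_isometry (f : R * R -> R) : f \in Lfun mu 2%:E ->
  (\int[P]_w (W f w ^+ 2)%:E = \int[mu]_p (f p ^+ 2)%:E)%E.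
Proof.
by case: hW => _ iso _ _ lf; rewrite -!poweR_Lnorm2 iso.
Qed.

Lemma wiener_Lfun (f : R * R -> R) : f \in Lfun mu 2%:E ->
  (W f : T -> R) \in Lfun P 2%:E.
Proof.
move=> lf; apply: Lfun2P; first exact: measurable_funPT.
rewrite wiener_isometry//.
by apply: integrable_lty => //; exact: Lfun2_integrable_sqr lf.
Qed.

(** Polarization: the isometry at f + g, whose Wiener integral is almost surely
    the sum of those of f and g, leaves the equality of the cross terms. *)
Lemma wiener_covariance (f g : R * R -> R) :
  f \in Lfun mu 2%:E -> g \in Lfun mu 2%:E ->
  ('E_P[W f \* W g] = \int[mu]_p (f p * g p)%:E)%E.
Proof.
move=> lf lg; have [lin _ _ _] := hW.
pose h := fun p => 1 * f p + g p.
have hE : h = f \+ g by apply/funext => p; rewrite /h mul1r.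
have lh : h \in Lfun mu 2%:E by rewrite hE; apply: rpredD => //; rewrite lee1n.
have Wh : (\int[P]_w ((W f w + W g w) ^+ 2)%:E = \int[mu]_p ((f p + g p) ^+ 2)%:E)%E.
  transitivity (\int[P]_w (W h w ^+ 2)%:E)%E; last first.
    by rewrite wiener_isometry//; apply: eq_integral => p _; rewrite hE.
  apply: ae_eq_integral => //.
  - by apply/measurable_EFinP; apply: measurable_funX; exact: measurable_funD.
  - by apply/measurable_EFinP; exact: measurable_funX.
  - have := lin 1 f g lf lg; apply: filterS => w -> _.
    by rewrite mul1r.
have lWf := wiener_Lfun lf; have lWg := wiener_Lfun lg.
move: Wh; rewrite (integral_sqrD lWf lWg) (integral_sqrD lf lg) !wiener_isometry//.
have fin2 q : q \in Lfun mu 2%:E -> (\int[mu]_p (q p ^+ 2)%:E)%E \is a fin_num.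
  by move=> lq; apply: integrable_fin_num => //; exact: Lfun2_integrable_sqr lq.
have := fin2 _ lf; have := fin2 _ lg.
have : (\int[P]_w (W f w * W g w)%:E)%E \is a fin_num.
  by apply: integrable_fin_num => //; exact: integrable_mul2.
have : (\int[mu]_p (f p * g p)%:E)%E \is a fin_num.
  by apply: integrable_fin_num => //; exact: integrable_mul2.
rewrite unlock /=.
move: (\int[mu]_p _)%E (\int[P]_w _)%E (\int[mu]_p _)%E (\int[mu]_p _)%E.
move=> [a| |] [b| |] [p| |] [q| |] // _ _ _ _.
by rewrite -!EFinM -!EFinD => -[] ?; congr EFin; lra.
Qed.

End isometry.

(** * Gaussian families with the same covariance *)

Section gaussian_families.
Context {R : realType}.

Definition joint {d} {T : measurableType d} {n : nat} (X : 'I_n -> {mfun T >-> R})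
  (w : T) : n.-tuple (measurableTypeR R) := [tuple X i w | i < n].

Lemma measurable_joint d (T : measurableType d) (n : nat)
    (X : 'I_n -> {mfun T >-> R}) : measurable_fun setT (joint X).
Proof.
apply/measurable_fun_tnthP => i.
rewrite (_ : _ \o _ = X i); first exact: (measurable_funPT (X i)).
by apply/funext => w; rewrite /joint/= tnth_mktuple.
Qed.

HB.instance Definition _ d (T : measurableType d) (n : nat)
    (X : 'I_n -> {mfun T >-> R}) :=
  isMeasurableFun.Build _ _ _ _ (joint X) (measurable_joint X).

Definition lincomb {d} {T : measurableType d} {n : nat}
    (X : 'I_n -> {mfun T >-> R}) (c : 'I_n -> R) : {mfun T >-> R} :=
  \sum_(i < n) c i *: X i.

Lemma lincombE d (T : measurableType d) (n : nat)
    (X : 'I_n -> {mfun T >-> R}) (c : 'I_n -> R) (w : T) :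
  lincomb X c w = \sum_(i < n) c i * X i w.
Proof. by rewrite /lincomb mfun_sum. Qed.

Lemma tuple_lin_joint d (T : measurableType d) (n : nat)
    (X : 'I_n -> {mfun T >-> R}) (c : 'I_n -> R) :
  tuple_lin c \o joint X = lincomb X c.
Proof.
apply/funext => w; rewrite lincombE; apply: eq_bigr => i _.
by rewrite /joint tnth_mktuple.
Qed.

Lemma lincomb_mean d (T : measurableType d) (P : probability T R)
    (n : nat) (X : 'I_n -> {mfun T >-> R}) (c : 'I_n -> R) :
  (forall i, (X i : T -> R) \in Lfun P 2%:E) -> (forall i, ('E_P[X i] = 0)%E) ->
  ('E_P[lincomb X c] = 0)%E.
Proof.
move=> L2 E0.
have iX i : P.-integrable setT (EFin \o X i).
  apply/Lfun1_integrable; apply: Lfun_subset12 => //.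
  by rewrite fin_num_measure.
rewrite unlock.
transitivity (\int[P]_w (\sum_(i < n) (c i)%:E * (X i w)%:E))%E.
  by apply: eq_integral => w _; rewrite lincombE -sumEFin.
rewrite integral_sum//; last by move=> i; apply: integrableZl => //; exact: iX.
rewrite big1// => i _; rewrite integralZl//; last exact: iX.
by have := E0 i; rewrite unlock => ->; rewrite mule0.
Qed.

Lemma lincomb_second_moment d (T : measurableType d) (P : probability T R)
    (n : nat) (X : 'I_n -> {mfun T >-> R}) (c : 'I_n -> R) (K : 'I_n -> 'I_n -> R) :
  (forall i, (X i : T -> R) \in Lfun P 2%:E) ->
  (forall i j, ('E_P[X i \* X j] = (K i j)%:E)%E) ->
  (\int[P]_w (lincomb X c w ^+ 2)%:E =
   (\sum_(i < n) \sum_(j < n) c i * c j * K i j)%:E)%E.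
Proof.
move=> L2 EK; under eq_integral do rewrite lincombE.
rewrite integral_sqr_sum// -sumEFin; apply: eq_bigr => i _.
rewrite -sumEFin; apply: eq_bigr => j _.
by rewrite [RHS]EFinM -EK unlock.
Qed.

(** Any linear combination is Gaussian with mean 0 and with a variance that
    depends only on K, so it has the same law for X and Y. *)
Lemma centered_gaussian_same_fdd d d' (T : measurableType d) (T' : measurableType d')
    (P : probability T R) (P' : probability T' R) (J : Type) (D : set J)
    (X : J -> {RV P >-> R}) (Y : J -> {RV P' >-> R}) (K : J -> J -> R) :
  centered_gaussian P D X -> centered_gaussian P' D Y ->
  (forall i j, D i -> D j -> ('E_P[X i \* X j] = (K i j)%:E)%E) ->
  (forall i j, D i -> D j -> ('E_P'[Y i \* Y j] = (K i j)%:E)%E) ->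
  same_fdd P P' D X Y.
Proof.
move=> [EX gX] [EY gY] KX KY n t Dt A mA.
have L2 dd (S : measurableType dd) (Q : probability S R) (Z : J -> {RV Q >-> R}) :
    (forall i j, D i -> D j -> ('E_Q[Z i \* Z j] = (K i j)%:E)%E) ->
    forall i, (Z (t i) : S -> R) \in Lfun Q 2%:E.
  move=> KZ i; apply: Lfun2P; first exact: measurable_funPT.
  have sqrE : (\int[Q]_w (Z (t i) w ^+ 2)%:E = (K (t i) (t i))%:E)%E.
    rewrite -(KZ _ _ (Dt i) (Dt i)) unlock.
    by apply: eq_integral => w _; rewrite expr2.
  by rewrite sqrE ltry.
set X' := fun i => X (t i); set Y' := fun i => Y (t i).
suff law_eq (c : 'I_n -> R) (C : set R) : measurable C ->
    P (lincomb X' c @^-1` C) = P' (lincomb Y' c @^-1` C).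
  apply: (@cramer_wold R n (distribution P (joint X')) (distribution P' (joint Y')))
    => // c C mC.
  have := law_eq c C mC; rewrite -!tuple_lin_joint; exact: id.
move=> mC.
pose v := \sum_(i < n) \sum_(j < n) c i * c j * K (t i) (t j).
apply: (gaussian_law_unique (P := P) (P' := P') (v := v)) mC.
- exact: gX.
- exact: gY.
- by apply: lincomb_mean => [i|i]; [exact: L2|exact: EX].
- by apply: lincomb_mean => [i|i]; [exact: L2|exact: EY].
- by apply: lincomb_second_moment => [i|i j]; [exact: L2|exact: KX].
- by apply: lincomb_second_moment => [i|i j]; [exact: L2|exact: KY].
Qed.

End gaussian_families.

(** * The process *)

Section Vstar.
Context {R : realType} {d : measure_display} {T : measurableType d}.
Variables (P : probability T R) (B : R -> R -> {RV P >-> R}).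
Variable W : (R * R -> R) -> {RV P >-> R}.
Hypothesis hW : wiener_integral P B W.
Variable beta : R.
Hypothesis hbeta : 0 < beta < 1.
Local Notation mu := (quadrant_measure R).

Lemma Vstar_integrandM (u s : R) (p : R * R) :
  Vstar_integrand beta u p * Vstar_integrand beta s p =
  \1_(Vstar_region beta u `&` Vstar_region beta s) p.
Proof. by rewrite indicI. Qed.

Lemma integral_Vstar_integrandM (u s : R) : 0 <= s -> s <= u ->
  (\int[mu]_p (Vstar_integrand beta u p * Vstar_integrand beta s p)%:E =
   ((u `^ (1 - beta) - (u - s) `^ (1 - beta)) / (1 - beta))%:E)%E.
Proof.
move=> s0 su; rewrite -Vstar_region_measure//.
under eq_integral do rewrite Vstar_integrandM.
rewrite integral_indic ?setIT//.
by apply: measurableI; exact: measurable_Vstar_region.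
Qed.

Lemma Vstar_integrand_Lfun (u : R) : 0 <= u ->
  Vstar_integrand beta u \in Lfun mu 2%:E.
Proof.
move=> u0; apply: Lfun2P.
  by apply: measurable_indic; exact: measurable_Vstar_region.
under eq_integral do rewrite expr2.
by rewrite integral_Vstar_integrandM// ltry.
Qed.

Lemma Vstar_centered_gaussian : centered_gaussian P `[0, +oo[ (Vstar P W beta).
Proof.
have [_ _ [EW gW] _] := hW; split.
  move=> u; rewrite /= in_itv/= andbT => u0.
  have lf := Vstar_integrand_Lfun u0.
  have iW : P.-integrable setT (EFin \o W (Vstar_integrand beta u)).
    apply/Lfun1_integrable; apply: Lfun_subset12; last exact: (wiener_Lfun hW).
    by rewrite fin_num_measure.
  rewrite unlock /Vstar/=.
  under eq_integral => w _ do rewrite /GRing.scale/= EFinM.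
  rewrite integralZl//; have := EW _ lf; rewrite unlock => ->.
  by rewrite mule0.
move=> n t c t0.
have := gW n (fun i => Vstar_integrand beta (t i)) (fun i => c i * Num.sqrt (1 - beta)).
under eq_bigr do rewrite -scalerA.
apply => i; apply: Vstar_integrand_Lfun.
by have := t0 i; rewrite /= in_itv/= andbT.
Qed.

Lemma Vstar_covariance (u s : R) : 0 <= s -> s <= u ->
  ('E_P[Vstar P W beta u \* Vstar P W beta s] =
   (u `^ (1 - beta) - (u - s) `^ (1 - beta))%:E)%E.
Proof.
move=> s0 su; have u0 := le_trans s0 su; have /andP[b0 b1] := hbeta.
have lu := Vstar_integrand_Lfun u0; have ls := Vstar_integrand_Lfun s0.
transitivity (\int[P]_w ((1 - beta)%:E *
    (W (Vstar_integrand beta u) w * W (Vstar_integrand beta s) w)%:E))%E.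
  rewrite unlock; apply: eq_integral => w _.
  rewrite /Vstar /GRing.scale/= -EFinM mulrACA -expr2 sqr_sqrtr//.
  by rewrite subr_ge0 ltW.
rewrite integralZl//; last first.
  by apply: integrable_mul2; exact: (wiener_Lfun hW).
have := wiener_covariance hW lu ls; rewrite integral_Vstar_integrandM// unlock.
move=> ->; rewrite -EFinM mulrC divfK//.
by rewrite gt_eqF// subr_gt0.
Qed.

End Vstar.

(** A covariance prescribed for s <= u only is prescribed everywhere by
    symmetry. *)
Lemma covariance_max_min (R : realType) d (T : measurableType d) (P : probability T R)
    (X : R -> {RV P >-> R}) (k : R -> R -> R) :
  (forall u s : R, 0 <= s -> s <= u -> ('E_P[X u \* X s] = (k u s)%:E)%E) ->
  forall i j : R, `[0, +oo[%classic i -> `[0, +oo[%classic j ->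
    ('E_P[X i \* X j] = (k (Num.max i j) (Num.min i j))%:E)%E.
Proof.
move=> kE i j; rewrite /= !in_itv/= !andbT => i0 j0.
have [ij|ji] := leP i j; last by rewrite kE// ltW.
rewrite -kE//; congr expectation; apply/funext => w /=; exact: mulrC.
Qed.

Theorem mainTheorem3 (R : realType) (d : measure_display)
    (T : measurableType d) (P : probability T R) (beta : R)
    (B : R -> R -> {RV P >-> R}) (W : (R * R -> R) -> {RV P >-> R})
    (hbeta : 0 < beta < 1) (hB : brownian_sheet P B)
    (hW : wiener_integral P B W) :
  [/\ centered_gaussian P `[0, +oo[ (Vstar P W beta),
      forall u s : R, 0 <= s -> s <= u ->
        ('E_P[Vstar P W beta u \* Vstar P W beta s] =
          (u `^ (1 - beta) - (u - s) `^ (1 - beta))%:E)%E &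
      forall (d' : measure_display) (T' : measurableType d')
        (P' : probability T' R) (V : R -> {RV P' >-> R}),
        centered_gaussian P' `[0, +oo[ V ->
        (forall u s : R, 0 <= s -> s <= u ->
          ('E_P'[V u \* V s] =
            (u `^ (1 - beta) - (u - s) `^ (1 - beta))%:E)%E) ->
        same_fdd P P' `[0, +oo[ (Vstar P W beta) V].
Proof.
have gV := Vstar_centered_gaussian hW hbeta.
have cV := Vstar_covariance hW hbeta.
split => // d' T' P' V gV' cV'.
by apply: (centered_gaussian_same_fdd gV gV');
  apply: (covariance_max_min (k := fun u s => u `^ (1 - beta) - (u - s) `^ (1 - beta))).
Qed.
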